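(* Let $(X,d,\mu)$ be a metric measure space, let $g$ be a locally integrable function on $X$, and let $R>0$. If $(X,d)$ has the equal radius Besicovitch intersection property with constant $E=E(X,d)<\infty$, then for every $1\le p<\infty$, $$\|g*\mathbf 1_{B(\cdot,R)}\|_{L^p(\mu)}\le \Big(\sup_{x\in X}\mu(B(x,R))\Big)\,E^{1/p}\,\|g\|_{L^p(\mu)},$$ and $$\|g*\mathbf 1_{B(\cdot,R)}\|_{L^\infty(\mu)}\le \Big(\sup_{x\in X}\mu(B(x,R))\Big)\,\|g\|_{L^\infty(\mu)}.$$
   Context: Balls. In a metric space $(X,d)$, $B^{o}(x,r)=\{y: d(x,y)<r\}$ and $B^{cl}(x,r)=\{y: d(x,y)\le r\}$. The notation $B(x,r)$ means that all balls considered are of the same kind, i.e. all open or all closed; the result holds for either choice. Metric measure space. A Borel measure $\mu$ is $\tau$-additive if for every collection $\{U_\alpha:\alpha\in\Lambda\}$ of open sets, $\mu(\bigcup_\alpha U_\alpha)=\sup \mu(\bigcup_{i=1}^n U_{\alpha_i})$, the supremum being over all finite subcollections. $(X,d,\mu)$ is a metric measure space if $\mu$ is a $\tau$-additive (nonnegative) Borel measure on the metric space $(X,d)$ which assigns finite measure to bounded Borel sets. Equal radius Besicovitch intersection property. A ball is a set of points, which may have several centers and radii. A collection $\mathcal C$ of balls is a Besicovitch family if for each $B\in\mathcal C$ one can choose a center and a radius such that whenever $B_1,B_2\in\mathcal C$ are distinct balls, neither contains the chosen center of the other. Let $\mathcal E(X,d)$ be the collection of all families $\mathcal C$ for which such a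 choice of centers and radii can be made making $\mathcal C$ a Besicovitch family with, in addition, all chosen radii equal (the common radius may depend on $\mathcal C$). Set $$E(X,d)=\sup\Big\{\sum_{B\in\mathcal C}\mathbf 1_{B}(y): y\in X,\ \mathcal C\in\mathcal E(X,d)\Big\}.$$ $(X,d)$ has the equal radius Besicovitch intersection property with constant $E(X,d)$ if $E(X,d)<\infty$. (The value of the constant is the same for open balls and for closed balls.) Metric convolution. $g*\mathbf 1_{B(\cdot,R)}$ is the function $x\mapsto g*\mathbf 1_{B(x,R)}:=\int_{B(x,R)} g(y)\,d\mu(y)$. Conventions. Locally integrable is understood as: $g$ is $\mu$-measurable and $\int_B|g|\,d\mu<\infty$ for every ball $B$. The convention $0\cdot\infty=0$ is used, and norms may equal $+\infty$. *)

(* Defs.v *)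
From HB Require Import structures.
From mathcomp Require Import all_boot all_order all_algebra.
From mathcomp Require Import all_classical all_reals all_analysis.
From mathcomp Require Import measurable_realfun.

Set Implicit Arguments.
Unset Strict Implicit.
Unset Printing Implicit Defensive.

Import Order.TTheory GRing.Theory Num.Theory.
Import numFieldNormedType.Exports.

Local Open Scope classical_set_scope.
Local Open Scope ring_scope.

#[short(type="metricMeasurableType")]
HB.structure Definition MetricMeasurable (d : measure_display)
  (R : realType) := { T of Measurable d T & Metric R T }.

Variant ball_kind := OpenBall | ClosedBall.

Section Balls.
Context {R : realType} {T : metricType R}.
Implicit Types (k : ball_kind) (C : set (set T)).

(* The library's [closed_ball] is the closure of the open ball, which in a
   general metric space may be smaller than the set defined here. *)
Definition mball k (x : T) (r : R) : set T :=
  match k with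
  | OpenBall => [set y | mdist x y < r]
  | ClosedBall => [set y | mdist x y <= r]
  end.

Definition mbounded (A : set T) : Prop :=
  exists x r, A `<=` [set y | mdist x y < r].

(* Balls are sets of points, so a centre and a radius have to be chosen for
   each member of [C]; the values of [c] and [r] outside [C] are irrelevant. *)
Definition besicovitch_choice k C (c : set T -> T) (r : set T -> R) : Prop :=
  (forall B, C B -> 0 < r B /\ B = mball k (c B) (r B)) /\
  (forall B1 B2, C B1 -> C B2 -> B1 <> B2 -> ~ B1 (c B2) /\ ~ B2 (c B1)).

Definition equal_radius_family k C : Prop :=
  exists c r, besicovitch_choice k C c r /\
    (forall B1 B2, C B1 -> C B2 -> r B1 = r B2).

End Balls.

Section Constant.
Context {R : realType}.
Local Open Scope ereal_scope.

Definition equal_radius_const (k : ball_kind) (T : metricType R) : \bar R :=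
  ereal_sup [set \esum_(B in C) (\1_B y)%:E
            | y in [set: T] & C in equal_radius_family k].

Definition equal_radius_besicovitch (k : ball_kind) (T : metricType R) : Prop :=
  equal_radius_const k T < +oo.

End Constant.

Section MetricMeasure.
Context {d : measure_display} {R : realType} {T : metricMeasurableType d R}.
Variable mu : {measure set T -> \bar R}.
Local Open Scope ereal_scope.

Definition tau_additive : Prop :=
  forall F : set (set T), F `<=` open ->
    mu (\bigcup_(U in F) U) =
    ereal_sup [set mu (\bigcup_(U in G) U)
              | G in [set G | finite_set G /\ G `<=` F]].

Definition metric_measure_space : Prop :=
  [/\ @measurable d T = <<s [set U : set T | open U] >>,
      tau_additive &
      forall A : set T, measurable A -> mbounded A -> mu A < +oo].

(* Measurability with respect to the [mu]-completion of the Borel sets. The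
   library integral of such a function is the integral for the completed
   measure: it is defined by suprema over measurable simple functions, and so
   does not see modifications on a negligible set. *)
Definition mu_measurable (g : T -> \bar R) : Prop :=
  forall Y : set (\bar R), measurable Y -> completed_algebra_gen mu (g @^-1` Y).

Definition loc_integrable (k : ball_kind) (g : T -> \bar R) : Prop :=
  mu_measurable g /\
  forall (x : T) (r : R), (0 < r)%R ->
    \int[mu]_(y in mball k x r) `|g y| < +oo.

Definition metric_conv (k : ball_kind) (g : T -> \bar R) (r : R) (x : T)
    : \bar R :=
  \int[mu]_(y in mball k x r) g y.

End MetricMeasure.

(* Main.v *)
Require Import Defs.
From HB Require Import structures.
From mathcomp Require Import all_boot all_order all_algebra.
From mathcomp Require Import all_classical all_reals all_analysis.
From mathcomp Require Import measurable_realfun ess_sup_inf lra.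

Set Implicit Arguments.
Unset Strict Implicit.
Unset Printing Implicit Defensive.

Import Order.TTheory GRing.Theory Num.Theory.
Import numFieldNormedType.Exports.

Local Open Scope classical_set_scope.
Local Open Scope ring_scope.
Local Open Scope ereal_scope.

(** Write [S] for the supremum of the measures of the balls of radius [rho].
    The equal radius constant is at least 1, because a single ball is an
    equal radius Besicovitch family covering its own centre once
    ([equal_radius_const_ge1]).  So it is enough to bound the [L^p] norm of the
    convolution by [S] times the [L^p] norm of [g].  This is the Schur test for
    the symmetric kernel [(x, y) |-> 1_(B(x, rho)) y], whose integrals in either
    variable are at most [S].  By Hoelder's inequality
    [|(g * 1_B) x|^p <= mu (B x)^(p-1) * \int_(B x) |g|^p]
    ([power_mean_le]); integrating in [x] and exchanging the integrals gives
    [\int |g * 1_B|^p <= S^(p-1) * S * \int |g|^p] ([integral_mball_le]).  For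
    [p = oo] the bound holds at every point.

    Tonelli's theorem needs the set of pairs [(x, y)] with [y] in [B(x, rho)] to
    be measurable for the product of the Borel sigma-algebras, which can fail
    when the space is not separable.  Tau-additivity repairs this: it provides a
    sequence of points whose closure has full measure ([ae_approx_sequence]),
    and with it a product measurable set whose sections are the balls for almost
    every centre ([ball_relation_measurable]).

    The function [g] is measurable only for the completed measure.  The integral
    being a supremum over simple functions, monotonicity up to a null set holds
    for arbitrary nonnegative functions ([ae_le_integral_ge0]).  This allows
    replacing [g] by a real-valued Borel function equal to it almost everywhere
    ([loc_integrable_ae_real]), and estimating the norm of the convolution
    without a proof that the convolution is measurable. *)

(** * Integrals of functions that need not be measurable *)

Section integral_without_measurability.
Context {d : measure_display} {T : measurableType d} {R : realType}.
Variable mu : {measure set T -> \bar R}.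
Implicit Types (D : set T) (f g : T -> \bar R).

Import HBNNSimple.

(** A simple function below [f] can be set to zero on a measurable null set
    containing the points where [f <= g] fails: this keeps its integral and puts
    it below [g]. *)
Lemma ae_le_integral_ge0 D f g :
  (forall x, D x -> 0 <= f x) -> (forall x, D x -> 0 <= g x) ->
  {ae mu, forall x, D x -> f x <= g x} ->
  \int[mu]_(x in D) f x <= \int[mu]_(x in D) g x.
Proof.
move=> f0 g0 [N [mN muN0 fgN]]; rewrite !ge0_integralE//.
apply: ge_ereal_sup => _ [s /= sf <-]; apply: ereal_sup_ubound.
exists (proj_nnsfun s (measurableC mN)) => /=.
  move=> x; rewrite /= /mindic indicE in_setC.
  have [xN|xN] /= := boolP (x \in N).
    by rewrite mulr0; apply: erestrict_ge0.
  rewrite mulr1 (le_trans (sf x))// !patchE; case: ifPn => // /set_mem Dx.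
  move: xN; rewrite notin_setE => Nx; apply: contrapT => fgx.
  by apply: Nx; apply: fgN => /=; apply/not_implyP; split.
rewrite -!integralT_nnsfun; apply: ge0_ae_eq_integral => //.
- exact/measurable_EFinP/measurable_funPT.
- exact/measurable_EFinP/measurable_funPT.
- by move=> x _; rewrite lee_fin.
- by move=> x _; rewrite lee_fin.
exists N; split => // x /= /not_implyP[_ sx]; apply: contrapT => Nx; apply: sx.
by rewrite /mindic indicE mem_set// mulr1.
Qed.

Lemma ae_eq_integral_ge0 D f g :
  (forall x, D x -> 0 <= f x) -> (forall x, D x -> 0 <= g x) ->
  {ae mu, forall x, D x -> f x = g x} ->
  \int[mu]_(x in D) f x = \int[mu]_(x in D) g x.
Proof.
by move=> f0 g0 fg; apply/eqP; rewrite eq_le; apply/andP; split;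
  apply: ae_le_integral_ge0 => //; apply: filterS fg => x + Dx => /(_ Dx) ->.
Qed.

Lemma le_integral_ge0 D f g :
  (forall x, D x -> 0 <= f x) -> (forall x, D x -> f x <= g x) ->
  \int[mu]_(x in D) f x <= \int[mu]_(x in D) g x.
Proof.
move=> f0 fg; apply: ae_le_integral_ge0 => //; last exact: aeW.
by move=> x Dx; rewrite (le_trans (f0 _ Dx))// fg.
Qed.

Lemma abse_integral_le D f :
  `|\int[mu]_(x in D) f x| <= \int[mu]_(x in D) `|f x|.
Proof.
rewrite integralE.
have : \int[mu]_(x in D) f^\+ x <= \int[mu]_(x in D) `|f x|.
  apply: le_integral_ge0 => // x _.
  by rewrite -[leRHS]/((abse \o f) x) fune_abse leeDl.
have : \int[mu]_(x in D) f^\- x <= \int[mu]_(x in D) `|f x|.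
  apply: le_integral_ge0 => // x _.
  by rewrite -[leRHS]/((abse \o f) x) fune_abse leeDr.
have : 0 <= \int[mu]_(x in D) f^\+ x by exact: integral_ge0.
have : 0 <= \int[mu]_(x in D) f^\- x by exact: integral_ge0.
move: (\int[mu]_(x in D) _) (\int[mu]_(x in D) _) (\int[mu]_(x in D) _).
move=> [a| |] [b| |] [c| |]//=; rewrite ?lee_fin// => a0 b0 ac bc.
  by rewrite ler_norml; lra.
by rewrite leey.
Qed.

(** The sets [q < g], for [q] rational, are countably many and determine [g].
    Off one null set [N] each of them coincides with a measurable set, so that
    changing [g] to zero on [N] makes it measurable. *)
Lemma completed_measurable_ae_eq g :
  (forall Y, measurable Y -> completed_algebra_gen mu (g @^-1` Y)) ->
  exists2 h, measurable_fun setT h & {ae mu, forall x, g x = h x}.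
Proof.
move=> mg.
(* an enumeration of the rationals, as real numbers *)
pose e (n : nat) : R := ratr (odflt 0%R (unpickle n : option rat)).
pose P (n : nat) (AN : set T * set T) := [/\ measurable AN.1, measurable AN.2,
  mu AN.2 = 0 & forall x, ~ AN.2 x -> ((e n)%:E < g x) = AN.1 x :> Prop].
have /choice[AN ANP] : forall n, exists AN, P n AN.
  move=> n; have /= := mg `](e n)%:E, +oo[%classic (emeasurable_itv _).
  move=> [A mA [N [M [mM muM NM]]] AN].
  exists (A, M); split => //= x Mx.
  have -> : ((e n)%:E < g x) = (g x \in `](e n)%:E, +oo[).
    by rewrite in_itv/= andbT.
  have -> : (g x \in `](e n)%:E, +oo[) = (A `|` N) x :> Prop by rewrite AN.
  by apply/propext; split => [[//|/NM//]|]; left.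
pose N := \bigcup_n (AN n).2.
have mN : measurable N.
  by apply: bigcupT_measurable => n; have [] := ANP n.
have muN : mu N = 0.
  apply/(negligibleP mu mN); apply: negligible_bigcup => n.
  by have [_ mNn muNn _] := ANP n; exists (AN n).2; split.
exists (fun x => if x \in N then 0 else g x); last first.
  exists N; split => // x /=; apply: contra_notP => Nx.
  by rewrite ifN// notin_setE.
apply: (measurability _ (ErealGenOInfty.measurableE R)).
move=> _ [_ [r ->] <-]; rewrite setTI.
rewrite [X in measurable X](_ : _ =
  ((\bigcup_(n in [set n | r < e n]%R) (AN n).1) `\` N) `|`
   (N `&` [set _ | r%:E < 0])); last first.
  apply/seteqP; split => x /=; rewrite in_itv/= andbT.
    case: ifPn => [/set_mem Nx r0|]; first by right.
    rewrite notin_setE => Nx rg; left; split => //.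
    have [q rq qg] : exists2 q : rat, (r < ratr q)%R & (ratr q)%:E < g x.
      case: (g x) rg => [s| |]// rs.
        have [q] := rat_in_itvoo rs; rewrite in_itv/= => /andP[rq qs].
        by exists q.
      have [q] := @rat_in_itvoo R r (r + 1)%R ltac:(by rewrite ltrDl).
      by rewrite in_itv/= => /andP[rq _]; exists q => //; rewrite ltry.
    have eq : e (pickle q) = ratr q by rewrite /e pickleK.
    exists (pickle q); first by rewrite /= eq.
    have [_ _ _ <-] := ANP (pickle q); first by rewrite eq.
    by move=> Nq; apply: Nx; exists (pickle q).
  move=> [[[n /= rn An] Nx]|[Nx r0]]; last by rewrite mem_set.
  rewrite memNset//; apply: (@lt_trans _ _ (e n)%:E) => //.
  by have [_ _ _ ->] := ANP n => // Nn; apply: Nx; exists n.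
apply: measurableU.
  apply: measurableD => //; apply: bigcup_measurable => n _.
  by have [] := ANP n.
apply: measurableI => //.
by have [r0|r0] := boolP (r%:E < 0); [rewrite (_ : mkset _ = setT)//|
  rewrite (_ : mkset _ = set0)//]; apply/seteqP; split => //= x /negP.
Qed.

End integral_without_measurability.

(** * Hoelder and Tonelli *)

Section power_mean.
Context {d : measure_display} {T : measurableType d} {R : realType}.
Variable mu : {measure set T -> \bar R}.

Lemma le_poweR (x y : \bar R) (r : R) :
  (0 <= r)%R -> 0 <= x -> x <= y -> x `^ r <= y `^ r.
Proof.
move=> r0 x0 xy; apply: gt0_ler_poweR => //; rewrite in_itv/= leey andbT//.
exact: le_trans xy.
Qed.

(** For [p > 1] this is Hoelder's inequality for the functions [h * 1_B] and
    [1_B], raised to the power [p]: with [q] conjugate to [p], the exponent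
    [p / q] of the measure of [B] is [p - 1]. *)
Lemma power_mean_le (B : set T) (h : T -> R) (p : R) :
  measurable B -> measurable_fun setT h -> (1 <= p)%R ->
  (\int[mu]_(x in B) `|h x|%:E) `^ p <=
    mu B `^ (p - 1) * \int[mu]_(x in B) `|(h x)%:E| `^ p.
Proof.
move=> mB mh; rewrite le_eqVlt => /predU1P[<-|p1].
  rewrite subrr poweRe0 mul1e poweRe1; last exact: integral_ge0.
  by apply: le_integral_ge0 => // x Bx; rewrite poweRe1.
have p0 : (0 < p)%R by rewrite (lt_trans _ p1).
pose q := (p / (p - 1))%R.
have pq : (p^-1 + q^-1 = 1)%R.
  rewrite /q invf_div -[X in (X + _)%R]div1r -mulrDl addrC subrK divff//.
  by rewrite gt_eqF.
have q0 : (0 < q)%R by rewrite divr_gt0// subr_gt0.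
have := hoelder mu (measurable_funM mh (measurable_indic mB))
  (measurable_indic mB) p0 q0 pq.
rewrite Lnorm1.
have -> : \int[mu]_x `|(EFin \o ((h \* \1_B) \* \1_B)%R) x| =
          \int[mu]_(x in B) `|h x|%:E.
  rewrite [RHS]integral_mkcond; apply: eq_integral => x _ /=.
  by rewrite patchE indicE; case: ifPn => _; rewrite ?(mulr1, mulr0)// normr0.
move=> /(le_poweR (ltW p0) (integral_ge0 _ _)) le_p.
apply: (le_trans (le_p _)) => //.
have -> : 'N[mu]_q%:E[EFin \o \1_B] = mu B `^ q^-1.
  rewrite unlock -[B in RHS]setIT -integral_indic//; congr (_ `^ _).
  apply: eq_integral => x _ /=; rewrite indicE.
  by case: (x \in B); rewrite ?normr1 ?normr0 ?powR1 ?powR0 ?gt_eqF.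
rewrite poweRM ?Lnorm_ge0 ?poweR_ge0// poweR_Lnorm ?gt_eqF// -poweRrM.
rewrite muleC (_ : (q^-1 * p)%R = (p - 1)%R); last first.
  by rewrite /q invf_div -mulrA mulVf ?mulr1// gt_eqF.
apply: lee_wpmul2l; first exact: poweR_ge0.
rewrite [leRHS]integral_mkcond le_eqVlt; apply/orP; left; apply/eqP.
apply: eq_integral => x _ /=; rewrite patchE indicE.
by case: ifPn => _; rewrite ?(mulr1, mulr0)// normr0 powR0// gt_eqF.
Qed.

End power_mean.

Lemma tonelli_sigma_finite (d : measure_display) (T : measurableType d)
    (R : realType) (mu : {measure set T -> \bar R}) (f : T * T -> \bar R) :
  sigma_finite setT mu -> measurable_fun setT f -> (forall z, 0 <= f z) ->
  \int[mu]_x \int[mu]_y f (x, y) = \int[mu]_y \int[mu]_x f (x, y).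
Proof.
move=> fin_mu mf f0.
pose H1 := isSFinite.Build _ _ _ _ (sfinite_measure_sigma_finite fin_mu).
pose H2 := isSigmaFinite.Build _ _ _ _ fin_mu.
pose m := HB.pack_for (SigmaFiniteMeasure.type T R) (Measure.sort mu) H1 H2.
exact: (@fubini_tonelli _ _ _ _ _ m m).
Qed.

(** * Balls in a metric measure space *)

Section metric_measure_space.
Context {d : measure_display} {R : realType} {T : metricMeasurableType d R}.
Variable mu : {measure set T -> \bar R}.
Hypothesis mmsT : metric_measure_space mu.
Implicit Types (k : ball_kind) (x y : T) (r : R).

Lemma measurable_open (U : set T) : open U -> measurable U.
Proof. by case: mmsT => -> _ _ oU; exact: sub_sigma_algebra. Qed.

Lemma open_mball x r : open (mball OpenBall x r).
Proof.
rewrite openE => y /= xy.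
apply/metricType_numDomainType.nbhs_mdistP; exists (r - mdist x y)%R => /=.
  by rewrite subr_gt0.
move=> z /= yz; rewrite (le_lt_trans (metric_triangle _ y _))//; lra.
Qed.

Lemma mball_closedE x r :
  mball ClosedBall x r = \bigcap_n mball OpenBall x (r + n.+1%:R^-1).
Proof.
apply/seteqP; split => y /=.
  by move=> xy n _ /=; rewrite (le_lt_trans xy)// ltrDl.
move=> xy; apply/ler_addgt0Pl => e e0.
have [n _ /(_ n (leqnn _)) ne] := near_infty_natSinv_lt (PosNum e0).
by rewrite ltW// (lt_trans (xy n I))// addrC ltrD2r.
Qed.

Lemma measurable_mball k x r : measurable (mball k x r).
Proof.
case: k; first exact/measurable_open/open_mball.
rewrite mball_closedE; apply: bigcapT_measurable => n.
exact/measurable_open/open_mball.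
Qed.

Lemma mball_lty k x r : mu (mball k x r) < +oo.
Proof.
case: mmsT => _ _; apply; first exact: measurable_mball.
exists x, (r + 1)%R => y; case: k => /= xy; rewrite ?(lt_trans xy) ?ltrDl//.
by rewrite (le_lt_trans xy)// ltrDl.
Qed.

Lemma mball_sym k x y r : mball k x r y = mball k y r x.
Proof. by case: k => /=; rewrite metric_sym. Qed.

Lemma mball_cover k x : \bigcup_n mball k x n.+1%:R = setT.
Proof.
apply/seteqP; split => // y _; exists (Num.truncn (mdist x y)) => //.
by case: k => /=; rewrite ?ltW// truncnS_gt.
Qed.

Lemma sigma_finite_mu : sigma_finite setT mu.
Proof.
exists (fun n => mball OpenBall point n.+1%:R); first by rewrite mball_cover.
by move=> n; split; [exact: measurable_mball|exact: mball_lty].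
Qed.

(** For every [n], tau-additivity supplies a finite subfamily whose union has
    measure within [1 / n] of that of the whole union; these subfamilies
    together cover all but a null set. *)
Lemma tau_additive_countable (F : set (set T)) : F `<=` open ->
  mu (\bigcup_(U in F) U) < +oo ->
  exists G : set (set T), [/\ countable G, G `<=` F &
    mu (\bigcup_(U in F) U `\` \bigcup_(U in G) U) = 0].
Proof.
move=> oF Foo; have [_ tau _] := mmsT.
have mF (G : set (set T)) : G `<=` F -> measurable (\bigcup_(U in G) U).
  by move=> GF; apply/measurable_open/bigcup_open => U /GF/oF.
have Ffin : mu (\bigcup_(U in F) U) \is a fin_num by rewrite ge0_fin_numE.
have /choice[G GP] : forall n : nat, exists G : set (set T),
    [/\ finite_set G, G `<=` F &
      mu (\bigcup_(U in F) U) - n.+1%:R^-1%:E < mu (\bigcup_(U in G) U)].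
  move=> n; have := Ffin; rewrite tau//.
  move=> /(@ub_ereal_sup_adherent R _ n.+1%:R^-1).
  by case=> // _ [G [finG GF] <-] lt; exists G.
exists (\bigcup_n G n); split.
- apply: bigcup_countable => // n _; apply: finite_set_countable.
  by have [] := GP n.
- by move=> U [n _ GU]; have [_ + _] := GP n; exact.
apply/eqP; rewrite -measure_le0; apply/lee_addgt0Pr => e e0; rewrite add0e.
have [n _ /(_ n (leqnn _)) ne] := near_infty_natSinv_lt (PosNum e0).
have [_ GF Gn] := GP n.
have GGn : \bigcup_(U in G n) U `<=` \bigcup_(U in \bigcup_n G n) U.
  by move=> x [U GU Ux]; exists U => //; exists n.
apply: (@le_trans _ _ (mu (\bigcup_(U in F) U `\` \bigcup_(U in G n) U))).
  apply: le_measure; rewrite ?inE.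
  - apply: measurableD; [exact: mF|apply: mF].
    by move=> U [m _ GU]; have [_ + _] := GP m; exact.
  - by apply: measurableD; exact: mF.
  - by apply: setDS.
rewrite measureD//; [|exact: mF|exact: mF].
rewrite setIidr; last by apply: bigcup_subset.
have Gnfin : mu (\bigcup_(U in G n) U) \is a fin_num.
  rewrite ge0_fin_numE// (le_lt_trans _ Foo)// le_measure ?inE//.
  - exact: mF.
  - exact: mF.
  - exact: bigcup_subset.
rewrite leeBlDr//; move: Gn; rewrite lteBlDr// => /ltW /le_trans; apply.
by rewrite addeC leeD2r// lee_fin ltW.
Qed.


(** The balls of radius [1 / n], cut by a fixed large ball to make the measure
    of their union finite, form an open cover of that large ball.  By
    [tau_additive_countable] countably many of them cover almost all of it, and
    their centres are collected over all [n] and all large balls. *)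
Lemma ae_approx_sequence : exists q : nat -> T,
  {ae mu, forall x, forall n : nat, exists i,
     mball OpenBall (q i) n.+1%:R^-1 x}.
Proof.
have /choice[Q QP] : forall nm : nat * nat, exists Q : set T, countable Q /\
    {ae mu, forall x, mball OpenBall point nm.2.+1%:R x ->
      exists2 q, Q q & mball OpenBall q nm.1.+1%:R^-1 x}.
  move=> [n m] /=.
  pose W (y : T) :=
    mball OpenBall y n.+1%:R^-1 `&` mball OpenBall point m.+1%:R.
  have WE : \bigcup_(U in range W) U = mball OpenBall point m.+1%:R.
    rewrite bigcup_image; apply/seteqP; split => [x [y _ []//]|x xm].
    by exists x => //; split => //=; rewrite mdistxx.
  have [U [y _ <-]||G [cG GW muG]] := @tau_additive_countable (range W).
  - by apply: openI; exact: open_mball.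
  - by rewrite WE mball_lty.
  have /choice[c cP] : forall U, exists y, G U -> U = W y.
    move=> U; have [/GW [y _ <-]|GU] := pselect (G U); first by exists y.
    by exists point.
  exists (c @` G); split; first exact: sub_countable (card_image_le _ _) cG.
  exists (\bigcup_(U in range W) U `\` \bigcup_(U in G) U); split => //.
    apply: measurableD; apply/measurable_open/bigcup_open => U.
      by move=> [y _ <-]; apply: openI; exact: open_mball.
    by move=> /GW [y _ <-]; apply: openI; exact: open_mball.
  move=> x /= /not_implyP[xm nQ]; split; first by rewrite WE.
  move=> [U GU Ux]; apply: nQ; exists (c U); first by exists U.
  by move: Ux; rewrite {1}(cP U GU) => -[].
have cQ : countable (\bigcup_nm Q nm).
  by apply: bigcup_countable => // nm _; have [] := QP nm.
have [q Qq] : exists q : nat -> T, \bigcup_nm Q nm `<=` range q.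
  have [->|[q]] := pfcard_geP cQ; first by exists (fun=> point).
  by exists q; exact: surj.
exists q.
have : {ae mu, forall x, forall n m : nat, mball OpenBall point m.+1%:R x ->
    exists2 q, Q (n, m) q & mball OpenBall q n.+1%:R^-1 x}.
  apply: ae_foralln => n; apply: ae_foralln => m.
  by have [_] := QP (n, m).
apply: filterS => x xQ n.
have : [set: T] x by [].
rewrite -(mball_cover OpenBall point) => -[m _ xm].
have [y Qy yx] := xQ n m xm.
have [|i _ qiy] := Qq y; first by exists (n, m).
by exists i; rewrite qiy.
Qed.

(** The relation [d(x, y) < s] contains the countable union [A s] of the
    rectangles [B(q i, 1 / n) x B(q i, s - 1 / n)] by the triangle inequality.
    When [x] is a limit of points [q i], every [y] with [d(x, y) < s] is
    reached: take [1 / n] below half of [s - d(x, y)] and [q i] within [1 / n]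
    of [x].
    Closed balls are countable intersections of open ones. *)
Lemma ball_relation_measurable k r : exists A : set (T * T),
  [/\ measurable A, forall x y, A (x, y) -> mball k x r y &
    {ae mu, forall x, forall y, mball k x r y -> A (x, y)}].
Proof.
have [q aeq] := ae_approx_sequence.
pose A (s : R) : set (T * T) := \bigcup_i \bigcup_n
  (mball OpenBall (q i) n.+1%:R^-1 `*` mball OpenBall (q i) (s - n.+1%:R^-1)).
have mA s : measurable (A s).
  apply: bigcupT_measurable => i.
  apply: bigcupT_measurable => n.
  by apply: measurableX; exact: measurable_mball.
have Asub s x y : A s (x, y) -> mball OpenBall x s y.
  move=> [i _ [n _ [/= qx qy]]].
  rewrite (le_lt_trans (metric_triangle _ (q i) _))//.
  by rewrite metric_sym -(subrK n.+1%:R^-1%R s) addrC ltrD.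
have subA : {ae mu, forall x, forall s y, mball OpenBall x s y -> A s (x, y)}.
  apply: filterS aeq => x xQ s y /= xy.
  have e0 : (0 < (s - mdist x y) / 2)%R by rewrite divr_gt0// subr_gt0.
  have [n _ /(_ n (leqnn _)) /= ne] := near_infty_natSinv_lt (PosNum e0).
  have [i /= qx] := xQ n; exists i => //; exists n => //; split => //=.
  rewrite (le_lt_trans (metric_triangle _ x _))// ltrBrDr.
  by move: (n.+1%:R^-1)%R (mdist (q i) x) qx ne => /= a b; lra.
case: k.
  exists (A r); split => //; first exact: Asub.
  by apply: filterS subA => x + y; exact.
exists (\bigcap_n A (r + n.+1%:R^-1)%R); split.
- exact: bigcapT_measurable.
- by move=> x y Axy; rewrite mball_closedE => n _; apply: Asub; exact: Axy.
- apply: filterS subA => x xA y; rewrite mball_closedE => xy n _.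
  by apply: xA; exact: xy.
Qed.

(** After exchanging the integrals, the inner one is the measure of the set of
    centres [x] whose ball contains [y]; by symmetry of the distance it lies in
    the ball around [y]. *)
Lemma integral_mball_le k r (w : T -> \bar R) :
  measurable_fun setT w -> (forall x, 0 <= w x) ->
  \int[mu]_x \int[mu]_(y in mball k x r) w y <=
    ereal_sup [set mu (mball k x r) | x in [set: T]] * \int[mu]_y w y.
Proof.
move=> mw w0; set S := ereal_sup _.
have [A [mA Asub subA]] := ball_relation_measurable k r.
pose f (z : T * T) := w z.2 * (\1_A z)%:E.
have f0 z : 0 <= f z by rewrite mule_ge0// lee_fin.
have mf : measurable_fun setT f.
  apply: emeasurable_funM; first exact: measurableT_comp.
  by apply/measurable_EFinP; exact: measurable_indic.
apply: (@le_trans _ _ (\int[mu]_x \int[mu]_y f (x, y))).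
  apply: ae_le_integral_ge0 => [x _|x _|].
  - exact: integral_ge0.
  - exact: integral_ge0.
  apply: filterS subA => x xA _.
  rewrite integral_mkcond; apply: le_integral_ge0 => y _.
    exact: erestrict_ge0.
  rewrite patchE /f /= indicE; case: ifPn => [/set_mem /xA xy|_].
    by rewrite mem_set// mule1.
  by rewrite mule_ge0// lee_fin.
rewrite (tonelli_sigma_finite sigma_finite_mu)// -ge0_integralZl//; last first.
  apply: (le_trans (measure_ge0 mu (mball k point r))).
  by apply: ereal_sup_ubound; exists point.
apply: le_integral_ge0 => y _; first exact: integral_ge0.
under eq_integral do rewrite /f /=.
rewrite ge0_integralZl//; last first.
  by apply/measurable_EFinP; apply: measurableT_comp.
rewrite muleC lee_wpmul2r//.
apply: (@le_trans _ _ (mu (mball k y r))); last first.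
  by apply: ereal_sup_ubound; exists y.
have -> : mu (mball k y r) = \int[mu]_x (\1_(mball k y r) x)%:E.
  by rewrite integral_indic ?setIT//; exact: measurable_mball.
apply: le_integral_ge0 => x _; first by rewrite lee_fin.
rewrite lee_fin !indicE ler_nat.
case: (boolP ((x, y) \in A)) => // /set_mem /Asub.
by rewrite mball_sym => yx; rewrite mem_set.
Qed.

End metric_measure_space.

(** * Norms of the convolution *)

Section convolution.
Context {d : measure_display} {R : realType} {T : metricMeasurableType d R}.
Variables (mu : {measure set T -> \bar R}) (k : ball_kind) (g : T -> \bar R).
Hypotheses (mmsT : metric_measure_space mu) (intg : loc_integrable mu k g).

(** Countably many balls cover the space, and [g] is integrable, hence almost
    everywhere finite, on each of them. *)
Lemma loc_integrable_ae_real : exists2 h : T -> R,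
  measurable_fun setT h & {ae mu, forall x, g x = (h x)%:E}.
Proof.
have [mg ballg] := intg.
have [h mh gh] := completed_measurable_ae_eq mg.
have hfin : {ae mu, forall x, h x \is a fin_num}.
  have : {ae mu, forall x, forall n,
      mball k point n.+1%:R x -> h x \is a fin_num}.
    apply: ae_foralln => n; apply: integrable_ae.
      exact: (measurable_mball mmsT).
    apply/integrableP; split; first exact: measurable_funTS.
    rewrite -(_ : \int[mu]_(x in mball k point n.+1%:R) `|g x| =
      \int[mu]_(x in mball k point n.+1%:R) `|h x|) ?ballg//.
    by apply: ae_eq_integral_ge0 => //; apply: filterS gh => x ->.
  apply: filterS => x xfin; have : [set: T] x by [].
  by rewrite -(mball_cover k point) => -[n _]; exact: xfin.
exists (fine \o h); first exact: measurableT_comp.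
by apply: filterS2 gh hfin => x -> hx; rewrite /= fineK.
Qed.

Local Notation S r := (ereal_sup [set mu (mball k x r) | x in [set: T]]).

Let mball_le_sup r x : mu (mball k x r) <= S r.
Proof. by apply: ereal_sup_ubound; exists x. Qed.

Let sup_ge0 r : 0 <= S r.
Proof. exact: le_trans (mball_le_sup r point). Qed.

Lemma metric_conv_Lnorm_le p r : (1 <= p)%R ->
  'N[mu]_p%:E[metric_conv mu k g r] <= S r * 'N[mu]_p%:E[g].
Proof.
move=> p1; have p0 : (0 < p)%R by rewrite (lt_le_trans _ p1).
have [h mh gh] := loc_integrable_ae_real.
pose w x := `|(h x)%:E| `^ p.
have mw : measurable_fun setT w.
  apply: (measurableT_comp (measurable_poweR _)).
  by apply: measurableT_comp => //; apply/measurable_EFinP.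
have w0 x : 0 <= w x by exact: poweR_ge0.
have conv_le x : `|metric_conv mu k g r x| `^ p <=
    S r `^ (p - 1) * \int[mu]_(y in mball k x r) w y.
  apply: (@le_trans _ _ ((\int[mu]_(y in mball k x r) `|h y|%:E) `^ p)).
    apply: le_poweR => //; first exact: ltW.
    apply: (le_trans (abse_integral_le _ _ _)).
    apply: ae_le_integral_ge0 => //; apply: filterS gh => y -> _.
    by rewrite abse_EFin.
  apply: (le_trans (power_mean_le _ (measurable_mball mmsT k x r) mh p1)).
  apply: lee_wpmul2r; first by apply: integral_ge0 => y _; exact: w0.
  by apply: le_poweR => //; rewrite subr_ge0.
have J : \int[mu]_x `|g x| `^ p = \int[mu]_x w x.
  apply: ae_eq_integral_ge0 => [x _|//|]; first exact: poweR_ge0.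
  by apply: filterS gh => x ->.
rewrite unlock J.
have -> : S r * (\int[mu]_x w x) `^ p^-1 =
    (S r `^ (p - 1) * (S r * \int[mu]_x w x)) `^ p^-1.
  rewrite muleA -[X in _ * X * _](poweRe1 (sup_ge0 r)) -poweRD; last first.
    by rewrite add_neq0_poweRD_def// subrK gt_eqF.
  rewrite subrK poweRM ?poweR_ge0//; last exact: integral_ge0.
  by rewrite -poweRrM mulfV ?gt_eqF// poweRe1.
apply: le_poweR.
- by rewrite invr_ge0 ltW.
- by apply: integral_ge0 => x _; exact: poweR_ge0.
apply: (@le_trans _ _
  (\int[mu]_x (S r `^ (p - 1) * \int[mu]_(y in mball k x r) w y))).
  by apply: le_integral_ge0 => x _; [exact: poweR_ge0|exact: conv_le].
(* The constant goes inside the inner integral, since the outer integrand is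
   not known to be measurable. *)
have c0 : 0 <= S r `^ (p - 1) by exact: poweR_ge0.
under eq_integral => x _.
  rewrite -ge0_integralZl//; [over|exact: (measurable_mball mmsT)|].
  exact: measurable_funTS.
apply: (le_trans (integral_mball_le mmsT _ _ _ _)).
- exact: emeasurable_funM.
- by move=> x; exact: mule_ge0.
by rewrite ge0_integralZl// muleCA.
Qed.

Lemma metric_conv_Lnormy_le r :
  'N[mu]_+oo[metric_conv mu k g r] <= S r * 'N[mu]_+oo[g].
Proof.
rewrite unlock; case: ifPn => [muT|_]; last by rewrite mule0.
apply/ess_supP/aeW => x /=.
have N0 : 0 <= ess_sup mu (abse \o g).
  by apply: ess_sup_gee => //; apply: aeW => y /=; exact: abse_ge0.
apply: (le_trans (abse_integral_le _ _ _)).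
apply: (@le_trans _ _
  (\int[mu]_(y in mball k x r) cst (ess_sup mu (abse \o g)) y)).
  apply: ae_le_integral_ge0 => //.
  by apply: filterS (ess_sup_ge mu (abse \o g)) => y + _.
rewrite integral_cst; last exact: (measurable_mball mmsT).
by rewrite muleC lee_wpmul2r.
Qed.

End convolution.

Lemma equal_radius_const_ge1 (R : realType) (k : ball_kind) (T : metricType R)
  (x : T) : 1 <= equal_radius_const k T.
Proof.
have Bx : mball k x 1 x by case: k => /=; rewrite mdistxx.
set B := mball k x 1 in Bx.
apply: ereal_sup_ubound; exists x => //; exists [set B].
  exists (fun=> x), (fun=> 1%R); split => //; split.
    by move=> _ ->; split.
  by move=> _ _ -> ->.
by rewrite esum_set1 ?indicE ?mem_set// lee_fin.
Qed.

Theorem corollary2p8 (d : measure_display) (R : realType)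
    (T : metricMeasurableType d R) (mu : {measure set T -> \bar R})
    (k : ball_kind) (g : T -> \bar R) (rho : R) :
  metric_measure_space mu ->
  loc_integrable mu k g ->
  (0 < rho)%R ->
  equal_radius_besicovitch k T ->
  (forall p : R, (1 <= p)%R ->
    'N[mu]_p%:E [metric_conv mu k g rho] <=
      ereal_sup [set mu (mball k x rho) | x in [set: T]]
      * equal_radius_const k T `^ p^-1 * 'N[mu]_p%:E [g]) /\
  'N[mu]_+oo [metric_conv mu k g rho] <=
    ereal_sup [set mu (mball k x rho) | x in [set: T]] * 'N[mu]_+oo [g].
Proof.
move=> mmsT intg _ _; split; last exact: metric_conv_Lnormy_le.
move=> p p1; apply: le_trans (metric_conv_Lnorm_le mmsT intg rho p1) _.
apply: lee_wpmul2r; first exact: Lnorm_ge0.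
rewrite -[leLHS]mule1 lee_wpmul2l//.
  apply: (le_trans (measure_ge0 mu (mball k point rho))).
  by apply: ereal_sup_ubound; exists point.
rewrite -[leLHS](poweR1r p^-1); apply: le_poweR => //.
  by rewrite invr_ge0 (le_trans _ p1).
exact: equal_radius_const_ge1 point.
Qed.
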